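(* Let $G$ be a finite alphabet, let $\mathfrak{G}\subseteq G^{\mathbb{Z}}$ be a topological Markov chain using all letters of $G$, and let $(\mathfrak{G},\Phi)$ be a structurally compatible, right-permutative, $\Psi$-associative cellular automaton. Then $(\mathfrak{G},\Phi)$ is topologically conjugate through a $1$-block code to a product $(\mathfrak{K}\times\mathfrak{B},\Phi_{\mathfrak{K}}\times\mathbf{g}_{\mathfrak{B}})$, where $\mathfrak{K}$ and $\mathfrak{B}$ are topological Markov chains, $(\mathfrak{K},\Phi_{\mathfrak{K}})$ is a group cellular automaton, and $(\mathfrak{B},\mathbf{g}_{\mathfrak{B}})$ is a translation.
   Context: $\sigma$ is the shift map, $(\sigma(\mathbf{g}))_n=g_{n+1}$. A subshift $\mathfrak{G}\subseteq G^{\mathbb{Z}}$ is a topological Markov chain if for every allowed word $(g_1,\dots,g_k)$ the set of letters that may follow it depends only on $g_k$. A $1$-block code is a map $\Theta$ between shift spaces of the form $(\Theta(\mathbf{x}))_j=\theta(x_j)$ for a map $\theta$ of letters. Topologically conjugate through a $1$-block code means that there is a homeomorphism that is a $1$-block code and intertwines the two maps. A cellular automaton $(\mathfrak{G},\Phi)$ with radio $1$ is given by a map $\phi:G\times G\to G$ (the local rule) such that $\Phi(\mathbf{x})=(\phi(x_i,x_{i+1}))_{i\in\mathbb{Z}}$ maps $\mathfrak{G}$ into $\mathfrak{G}$; write $a\bullet b:=\phi(a,b)$. It is structurally compatible if it has radio $1$ and $(x_i),(y_i)\in\mathfrak{G}$ implies $(x_i\bullet y_i)_{i\in\mathbb{Z}}\in\mathfrak{G}$.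 It is right permutative if $g\mapsto w\bullet g$ is a permutation of $G$ for each $w\in G$. It is $\Psi$-associative if there is a permutation $\Psi:G\to G$ with $(a\bullet b)\bullet c=\Psi(a\bullet(b\bullet c))$ for all $a,b,c\in G$. For a topological Markov chain $\mathfrak{K}\subseteq K^{\mathbb{Z}}$ over a finite alphabet $K$, $(\mathfrak{K},\Phi_{\mathfrak{K}})$ is a group cellular automaton if its local rule is a group operation on $K$, i.e. $(\Phi_{\mathfrak{K}}(\mathbf{x}))_i=x_i\cdot x_{i+1}$ for a group operation $\cdot$ on $K$. For a topological Markov chain $\mathfrak{B}\subseteq B^{\mathbb{Z}}$ over a finite alphabet $B$, $(\mathfrak{B},\mathbf{g}_{\mathfrak{B}})$ is a translation if $\mathbf{g}_{\mathfrak{B}}=\mathbf{s}\circ\sigma$, where $\mathbf{s}:B^{\mathbb{Z}}\to B^{\mathbb{Z}}$ is the $1$-block code whose local rule is a permutation $s:B\to B$. *)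

(* Defs.v *)
From HB Require Import structures.
From mathcomp Require Import all_boot all_order all_algebra all_fingroup.
From mathcomp Require Import all_classical all_reals topology.

Set Implicit Arguments.
Unset Strict Implicit.
Unset Printing Implicit Defensive.

Import Order.TTheory GRing.Theory Num.Theory.

Local Open Scope classical_set_scope.
Local Open Scope ring_scope.

(* A^Z with the product of the discrete topologies. *)
Definition full_shift (A : choiceType) : Type :=
  prod_topology (fun _ : int => discrete_topology A).

HB.instance Definition _ (A : choiceType) := Topological.on (full_shift A).

Definition shift (A : choiceType) (x : full_shift A) : full_shift A :=
  fun i => x (i + 1).

Definition subshift (A : choiceType) (X : set (full_shift A)) : Prop :=
  closed X /\ @shift A @` X = X.

Definition allowed (A : choiceType) (X : set (full_shift A)) (w : seq A) : Prop :=
  exists2 x, X x & exists i : int, mkseq (fun j => x (i + j%:Z)) (size w) = w.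

Definition followers (A : choiceType) (X : set (full_shift A)) (w : seq A) :
  set A := [set a | allowed X (rcons w a)].

Definition topological_Markov_chain (A : choiceType) (X : set (full_shift A)) :
    Prop :=
  subshift X /\
  forall (u v : seq A) (g : A),
    allowed X (rcons u g) -> allowed X (rcons v g) ->
    followers X (rcons u g) = followers X (rcons v g).

Definition uses_all_letters (A : choiceType) (X : set (full_shift A)) : Prop :=
  forall a : A, exists2 x, X x & exists i : int, x i = a.

Definition ca_map (A : choiceType) (phi : A -> A -> A) (x : full_shift A) :
  full_shift A := fun i => phi (x i) (x (i + 1)).

(* The local rule is part of the data: the conditions below constrain phi on
   all of A * A, while [ca_map phi] on X only sees the allowed two-letter words. *)
Definition cellular_automaton (A : choiceType) (X : set (full_shift A))
  (phi : A -> A -> A) : Prop := forall x, X x -> X (ca_map phi x).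

Definition structurally_compatible (A : choiceType) (X : set (full_shift A))
    (phi : A -> A -> A) : Prop :=
  cellular_automaton X phi /\
  forall x y, X x -> X y -> X (fun i => phi (x i) (y i)).

Definition right_permutative (A : choiceType) (phi : A -> A -> A) : Prop :=
  forall w, bijective (phi w).

Definition Psi_associative (A : choiceType) (phi : A -> A -> A) : Prop :=
  exists2 Psi : A -> A, bijective Psi &
    forall a b c, phi (phi a b) c = Psi (phi a (phi b c)).

Definition group_cellular_automaton (K : finGroupType)
    (X : set (full_shift K)) : Prop :=
  cellular_automaton X (fun a b : K => (a * b)%g).

Definition one_block_code (A C : choiceType) (theta : A -> C)
  (x : full_shift A) : full_shift C := fun j => theta (x j).

Definition translation_map (B : choiceType) (s : B -> B) (x : full_shift B) :
  full_shift B := one_block_code s (shift x).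

Definition translation (B : choiceType) (X : set (full_shift B)) (s : B -> B) :
    Prop :=
  bijective s /\ forall x, X x -> X (translation_map s x).

(* The product of two shift spaces is seen as a shift space over the product
   alphabet, so that 1-block codes into it make sense. *)
Definition shift_prod (A C : choiceType) (X : set (full_shift A))
    (Y : set (full_shift C)) : set (full_shift (A * C)%type) :=
  [set z | X (fun i => (z i).1) /\ Y (fun i => (z i).2)].

Definition map_prod (A C : choiceType) (F : full_shift A -> full_shift A)
    (H : full_shift C -> full_shift C) (z : full_shift (A * C)%type) :
    full_shift (A * C)%type :=
  fun i => (F (fun j => (z j).1) i, H (fun j => (z j).2) i).

(* f restricts to a homeomorphism from X onto Y for the subspace topologies;
   only the values of f on X and of its inverse g on Y matter. *)
Definition homeomorphism_on (S T : topologicalType) (X : set S) (Y : set T)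
    (f : S -> T) : Prop :=
  [/\ set_bij X Y f, {within X, continuous f} &
      exists2 g : T -> S, {within Y, continuous g} & forall x, X x -> g (f x) = x].

Definition conjugate_through_1block (A C : choiceType)
    (X : set (full_shift A)) (F : full_shift A -> full_shift A)
    (Y : set (full_shift C)) (H : full_shift C -> full_shift C) : Prop :=
  exists theta : A -> C,
    homeomorphism_on X Y (one_block_code theta) /\
    forall x, X x -> one_block_code theta (F x) = H (one_block_code theta x).

(* Main.v *)
Require Import Defs.
From mathcomp Require Import all_boot all_order all_algebra all_fingroup cyclic.
From mathcomp Require Import all_classical all_reals topology.

Set Implicit Arguments.
Unset Strict Implicit.
Unset Printing Implicit Defensive.

Import GRing.Theory.

Local Open Scope classical_set_scope.
Local Open Scope ring_scope.

(** Write [a . b] for [phi a b], [L a] for the permutation [b |-> a . b], and let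
    products of permutations compose from left to right. The associativity law
    says exactly that [L (a . b) = L b * L a * Psi], so the permutations
    [pi a = L a * Psi] satisfy [pi (a . b) = pi b * (pi a ^ Psi)]. Finiteness
    yields a letter [c] with [pi c = 1], that is, one that acts by [Psi^-1];
    feeding it into this identity shows that [pi] is constant along the orbits
    of [Psi] and then, by applying [pi] to both sides of the associativity law,
    that every [pi a] commutes with [Psi]. Hence [k a = (pi a)^-1] is a
    homomorphism from [.] to the permutation group of [G]. The second coordinate
    of a letter is [e a = k a a], the point of the orbit of [a] under the group
    [k(G)] at which [k] is trivial. As [k a] is a permutation, [a] is recovered
    from [(k a, e a)]; moreover [e (a . b) = Psi^-1 (e b)]. In these coordinates
    [.] becomes [(h, u) . (h', u') = (h * h', Psi^-1 u')], a group law on the left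
    and a permutation of the second factor on the right
    ([Psi_associative_decomposition]).

    For the shift spaces, let [N] be an exponent of the permutation group. The
    term [m a b = a . (b . (... (b . b)))], with [N] letters [b] in all, has the
    coordinates [k (m a b) = k a] and [e (m a b) = e b]. Since the chain is
    closed under [.] applied letter by letter, it is closed under [m]: the
    coordinates of its points can be recombined freely, so it is the full
    product of its two coordinate images. The same recombination makes the
    images Markov chains ([image_topological_Markov_chain]): two words of an
    image that end with the same letter lift to words of the chain that end with
    the same letter. *)

(** * One-block codes and Markov chains *)

Lemma one_block_code_continuous (A C : choiceType) (theta : A -> C) :
  continuous (@one_block_code A C theta).
Proof.
move=> x; have Fx := @fmap_filter _ _ (one_block_code theta) _ (nbhs_filter x).
apply/cvg_sup => i.
apply: (@continuous_comp_initial _ (full_shift A) (discrete_topology C)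
  (fun f : int -> C => f i) (one_block_code theta)) => y.
apply: (@continuous_comp _ _ _ (fun z : full_shift A => (z i : discrete_topology A))
  (theta : discrete_topology A -> discrete_topology C)).
  exact: (@proj_continuous _ (fun _ : int => discrete_topology A) i).
by apply/discrete_cvg; apply: filterS (discrete_set1 _) => _ ->.
Qed.

Lemma full_shift_compact (A : finType) : compact [set: full_shift A].
Proof.
have := @tychonoff int (fun _ => discrete_topology A) (fun _ => setT).
rewrite (_ : [set f | _] = setT); last by apply/seteqP; split.
by apply=> _; apply: finite_compact; exact: finite_finset.
Qed.

Lemma full_shift_hausdorff (A : choiceType) : hausdorff_space (full_shift A).
Proof. by apply: hausdorff_product => _; exact: discrete_hausdorff. Qed.

(** Images of closed sets are closed because a full shift over a finite alphabet
    is compact. *)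
Lemma one_block_code_closed (A C : finType) (theta : A -> C)
    (X : set (full_shift A)) :
  closed X -> closed (one_block_code theta @` X).
Proof.
move=> clX; apply: compact_closed; first exact: full_shift_hausdorff.
apply: continuous_compact.
  by apply: continuous_subspaceT; exact: one_block_code_continuous.
exact: (subclosed_compact clX (@full_shift_compact A)).
Qed.

Lemma subshift_translate (A : choiceType) (X : set (full_shift A))
    (x : full_shift A) (n : int) :
  subshift X -> X x -> X (fun i : int => x (i + n)).
Proof.
move=> [_ shiftX]; elim/int_rect: n => [|n IH|n IH] in x *.
- by under eq_fun do rewrite addr0.
- move=> Xx; rewrite -shiftX; exists (fun i : int => x (i + n)); first exact: IH.
  by apply/funext=> i; rewrite /shift -addrA (addrC 1) intS (addrC 1).
- rewrite -{1}shiftX => -[y Xy yx].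
  rewrite (_ : (fun _ => _) = fun i : int => y (i - n%:Z)); first exact: IH.
  apply/funext=> i; rewrite -yx /shift; congr y.
  by rewrite intS opprD addrA (addrAC i) subrK.
Qed.

Lemma allowed_mkseq (A : choiceType) (X : set (full_shift A))
    (x : full_shift A) (i : int) (n : nat) :
  X x -> allowed X (mkseq (fun j => x (i + j%:Z)) n).
Proof. by move=> Xx; exists x => //; exists i; rewrite size_mkseq. Qed.

Lemma allowed_map (A C : choiceType) (theta : A -> C) (X : set (full_shift A))
    (w : seq A) :
  allowed X w -> allowed (one_block_code theta @` X) (map theta w).
Proof.
move=> [x Xx [i wE]]; exists (one_block_code theta x); first by exists x.
by exists i; rewrite size_map -[in RHS]wE -map_comp.
Qed.

(** In general the image of a Markov chain under a one-block code is only sofic: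
    a letter of the image has several preimages, with different followers. Here
    [m] repairs this. It keeps the image of its first argument and depends on that
    argument only through its image, so [m (y i) (x i)] is a preimage of the image
    of [y] that agrees with [m (x i) (x i)] wherever the images of [x] and [y]
    agree. *)
Lemma image_topological_Markov_chain (A C : finType) (X : set (full_shift A))
    (theta : A -> C) (m : A -> A -> A) :
  topological_Markov_chain X ->
  (forall x y, X x -> X y -> X (fun i => m (x i) (y i))) ->
  (forall a b, theta (m a b) = theta a) ->
  (forall a b c, theta a = theta b -> m a c = m b c) ->
  topological_Markov_chain (one_block_code theta @` X).
Proof.
move=> [subX markovX] mX theta_m m_theta.
have shiftE Y : one_block_code theta @` (@shift A @` Y) =
    @shift C @` (one_block_code theta @` Y).
  by rewrite !image_comp.
split.
  by split; [apply: one_block_code_closed; case: subX | rewrite -shiftE subX.2].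
suff sub u v g : allowed (one_block_code theta @` X) (rcons u g) ->
    allowed (one_block_code theta @` X) (rcons v g) ->
    followers (one_block_code theta @` X) (rcons u g) `<=`
    followers (one_block_code theta @` X) (rcons v g).
  by move=> u v g ug vg; apply/seteqP; split; apply: sub.
move=> _ [_ [y Xy <-] [j]] vE a [_ [x Xx <-] [i]].
move: vE; rewrite !size_rcons !mkseqS => /rcons_inj[vE gE].
move=> /rcons_inj[/rcons_inj[uE gE'] aE].
set p := size u in uE gE' aE; set q := size v in vE gE.
(* The translation of [x] aligns its last common letter with that of [y]. *)
pose x' : full_shift A := fun n => m (x n) (x n).
pose y' : full_shift A := fun n => m (y n) (x (n + (i + p%:Z - (j + q%:Z)))).
have Xx' : X x' by apply: mX.
have Xy' : X y' by apply: mX => //; exact: (subshift_translate _ subX Xx).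
have thetaX n : theta (x' n) = theta (x n) by apply: theta_m.
have thetaY n : theta (y' n) = theta (y n) by apply: theta_m.
have xy' : y' (j + q%:Z) = x' (i + p%:Z).
  rewrite /y' [X in x X]addrC subrK; apply: m_theta.
  by move: gE gE'; rewrite /one_block_code => -> ->.
have wx n : allowed X (mkseq (fun k => x' (i + k%:Z)) n) by exact: allowed_mkseq.
have wy n : allowed X (mkseq (fun k => y' (j + k%:Z)) n) by exact: allowed_mkseq.
have : followers X (rcons (mkseq (fun k => y' (j + k%:Z)) q) (x' (i + p%:Z)))
    (x' (i + p.+1%:Z)).
  rewrite -(markovX (mkseq (fun k => x' (i + k%:Z)) p)).
  - by have := wx p.+2; rewrite !mkseqS.
  - by have := wx p.+1; rewrite !mkseqS.
  - by have := wy q.+1; rewrite !mkseqS xy'.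
move=> /(allowed_map theta); rewrite !map_rcons /followers /= -map_comp !thetaX.
rewrite -[g]gE' -[a]aE -vE.
by rewrite (eq_map (g := fun k : nat => theta (y (j + k%:Z)))) // => k; exact: thetaY.
Qed.

(** * Psi-associative right permutative operations *)

(** The map [a |-> (k a, k a a)] is injective whatever [k] is, since [k a] is a
    permutation; so this presents [phi] as a group law times [s]. *)
Lemma Psi_associative_decomposition (G : finType) (phi : G -> G -> G) :
  right_permutative phi -> Psi_associative phi ->
  exists (k : G -> {perm G}) (s : {perm G}),
    (forall a b, k (phi a b) = (k a * k b)%g) /\
    (forall a b, k (phi a b) (phi a b) = s (k b b)).
Proof.
move=> phi_bij [Psi Psi_bij assoc].
pose P : {perm G} := perm (bij_inj Psi_bij).
pose L a : {perm G} := perm (bij_inj (phi_bij a)).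
have LE a b : L a b = phi a b by rewrite permE.
have L_phi a b : L (phi a b) = (L b * L a * P)%g.
  by apply/permP=> c; rewrite !permM !permE assoc.
pose pi a := (L a * P)%g.
have pi_phi a b : pi (phi a b) = (pi b * (pi a ^ P))%g.
  by rewrite /pi L_phi /conjg !mulgA mulgK.
(* The injective map [f] sends [L c] to [L (phi c a)], so the orbit of [L a]
   under [f] consists of left translations. As [f] has finite order, this orbit
   contains the preimage of [L a], some [L c] with [L a * L c * P = L a]. *)
have pi1 (a : G) : exists c, pi c = 1%g.
  pose f (t : {perm G}) := (L a * t * P)%g.
  have f_inj : injective f by move=> t u /mulIg/mulgI.
  have : finv f (L a) \in [set L c | c : G].
    rewrite /finv; elim: _.-1 => [|n]; first exact: imset_f.
    by rewrite iterS => /imsetP[c _ ->]; apply/imsetP; exists (phi c a); rewrite ?L_phi.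
  case/imsetP=> c _ Lc; exists c; apply: (mulgI (L a)).
  by rewrite mulg1 mulgA -/(f _) -Lc (f_finv f_inj).
have pi_P b : pi (P^-1%g b) = pi b.
  have [c pic] := pi1 b.
  have -> : P^-1%g b = phi c b by rewrite -LE -[L c](mulgK P) -/(pi c) pic mul1g.
  by rewrite pi_phi pic conj1g mulg1.
have pi_PJ a : (pi a ^ P)%g = pi a.
  have : pi (phi (phi a a) a) = pi (phi a (phi a a)).
    rewrite assoc -[LHS]pi_P; congr pi.
    by apply: (@perm_inj _ P); rewrite permKV permE.
  by rewrite !pi_phi conjMg mulgA => /mulgI /conjg_inj.
have pi_comm a : commute (pi a) P by apply/commgP/conjg_fixP.
have k_phi a b : (pi (phi a b))^-1%g = ((pi a)^-1 * (pi b)^-1)%g.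
  by rewrite pi_phi pi_PJ invMg.
exists (fun a => (pi a)^-1%g), P^-1%g; split=> // a b.
rewrite k_phi -LE -!permM; congr (fun_of_perm _ b).
have -> : L a = (P^-1 * pi a)%g.
  by rewrite -[LHS](mulgK P); exact: commuteV (pi_comm a).
by rewrite -mulgA mulKVg -!invMg (pi_comm b).
Qed.

(** * Splitting of the cellular automaton *)

Theorem theorem4p2 (G : finType) (XG : set (full_shift G)) (phi : G -> G -> G)
    (tmcG : topological_Markov_chain XG)
    (allG : uses_all_letters XG)
    (compat_phi : structurally_compatible XG phi)
    (rperm_phi : right_permutative phi)
    (assoc_phi : Psi_associative phi) :
  exists (K : finGroupType) (XK : set (full_shift K))
         (B : finType) (XB : set (full_shift B)) (s : B -> B),
    [/\ topological_Markov_chain XK,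
        topological_Markov_chain XB,
        group_cellular_automaton XK,
        translation XB s &
        conjugate_through_1block XG (ca_map phi)
          (shift_prod XK XB)
          (map_prod (ca_map (fun a b : K => (a * b)%g)) (translation_map s))].
Proof.
have [k [s [k_phi e_phi]]] := Psi_associative_decomposition rperm_phi assoc_phi.
pose e b : G := k b b.
have {}e_phi a b : e (phi a b) = s (e b) by apply: e_phi.
have [Xphi XphiX] := compat_phi.
pose N := #|[set: {perm G}]%G|.
pose m a b := phi a (iter N.-1 (phi b) b).
(* The inner iterate has coordinates [k b ^ N = 1] and [s ^ (N - 1) (e b)]; the
   outer product applies [s] once more, and [s ^ N = 1]. *)
have iter_k n b : k (iter n (phi b) b) = (k b ^+ n.+1)%g.
  by elim: n => // n IH; rewrite iterS k_phi IH -expgS.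
have iter_e n b : e (iter n (phi b) b) = (s ^+ n)%g (e b).
  by elim: n => [|n IH]; rewrite ?expg0 ?perm1 // iterS e_phi IH -permM -expgSr.
have N_gt0 : (0 < N)%N by exact: cardG_gt0.
have expN (t : {perm G}) : (t ^+ N = 1)%g by apply: expg_cardG; rewrite inE.
have k_m a b : k (m a b) = k a by rewrite k_phi iter_k prednK // expN mulg1.
have e_m a b : e (m a b) = e b.
  by rewrite e_phi iter_e -permM -expgSr prednK // expN perm1.
have ke_inj a b : k a = k b -> e a = e b -> a = b.
  by move=> kE; rewrite /e kE; exact: perm_inj.
have mX x y : XG x -> XG y -> XG (fun i => m (x i) (y i)).
  move=> Xx Xy; apply: (XphiX x) => //.
  by elim: N.-1 => // n IH; apply: (XphiX y).
exists {perm G}, (one_block_code k @` XG), G, (one_block_code e @` XG), s; split.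
- apply: (image_topological_Markov_chain (m := m)) => // a b c kE.
  by apply: ke_inj; rewrite ?k_m ?e_m.
- apply: (image_topological_Markov_chain (m := fun a b => m b a)) => //.
    by move=> x y Xx Xy; exact: mX.
  by move=> a b c eE; apply: ke_inj; rewrite ?k_m ?e_m.
- move=> _ [x Xx <-]; exists (ca_map phi x); first exact: Xphi.
  by apply/funext=> i; exact: k_phi.
- split=> [|_ [x Xx <-]]; first by exists (s^-1)%g; [exact: permK | exact: permKV].
  exists (ca_map phi x); first exact: Xphi.
  by apply/funext=> i; exact: e_phi.
- pose theta a := (k a, e a).
  exists theta; split; last first.
    move=> x Xx; apply/funext=> i.
    by rewrite /one_block_code /map_prod /theta /ca_map k_phi e_phi.
  (* Undoing [e a = k a a] letter by letter makes the inverse a one-block code,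
     which is continuous on the whole product. *)
  pose theta' (p : {perm G} * G) := (p.1^-1)%g p.2.
  have thetaK : cancel (one_block_code theta) (one_block_code theta').
    by move=> x; apply/funext=> i; rewrite /one_block_code /theta' /= permK.
  split.
  + split=> [x Xx|x y _ _|z [[x Xx xz] [y Xy yz]]].
    * by split; exists x.
    * by exact: (can_inj thetaK).
    * exists (fun i => m (x i) (y i)); first exact: mX.
      apply/funext=> i; rewrite /one_block_code /theta k_m e_m.
      have := congr1 (@^~ i) xz; have := congr1 (@^~ i) yz.
      by rewrite /one_block_code /= => -> ->; case: (z i).
  + by apply: continuous_subspaceT; exact: one_block_code_continuous.
  + exists (one_block_code theta') => [|x _]; last exact: thetaK.
    by apply: continuous_subspaceT; exact: one_block_code_continuous.
Qed.
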